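(* Let $\lambda,\kappa\ge 0$ and $\gamma>0$, and let $\{(X_t,v_t):t\ge 0\}$ be the run-and-tumble process on $\mathbb{Z}\times\{-1,1\}$ with parameters $(\lambda,\kappa,\gamma)$ (generator $L$ given in the context), started from $X_0=0$ and $v_0=\pm1$ with probability $1/2$ each. Then the large deviation free energy function $$F(\alpha)=\lim_{t\to\infty}\frac1t\log\mathbb{E}\left(e^{\alpha X_t}\right),\qquad \alpha\in\mathbb{R},$$ exists and is given by $$F(\alpha)=(2\kappa+\lambda)(\cosh(\alpha)-1)+\sqrt{\gamma^2+\lambda^2\sinh^2(\alpha)}-\gamma,$$ and $X_t/t$ satisfies the large deviation principle with rate function $$I(x)=\sup_{\alpha\in\mathbb{R}}\left(\alpha x-F(\alpha)\right),\qquad x\in\mathbb{R},$$ that is, $$\limsup_{t\to\infty}\frac1t\log\mathbb{P}\left(\frac{X_t}{t}\in B\right)\le-\inf_{x\in B}I(x)\quad\text{for all closed } B\subset\mathbb{R},$$ $$\liminf_{t\to\infty}\frac1t\log\mathbb{P}\left(\frac{X_t}{t}\in G\right)\ge-\inf_{x\in G}I(x)\quad\text{for all open } G\subset\mathbb{R}.$$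
   Context: The run-and-tumble process $\{(X_t,v_t):t\ge0\}$ with parameters $(\lambda,\kappa,\gamma)$ is the continuous-time Markov jump process on $\mathbb{Z}\times\{-1,1\}$ ($X_t$ is the position, $v_t$ the velocity) with generator $$Lf(x,v)=\lambda\big(f(x+v,v)-f(x,v)\big)+\kappa\big(f(x+1,v)+f(x-1,v)-2f(x,v)\big)+\gamma\big(f(x,-v)-f(x,v)\big).$$ Thus with rate $\lambda$ the particle jumps one step in the direction of its velocity, with rate $\kappa$ it jumps to each of its two neighbours, and with rate $\gamma$ the velocity flips from $v$ to $-v$. *)

(* Defs.v *)
From HB Require Import structures.
From mathcomp Require Import all_boot all_order all_algebra.
From mathcomp Require Import all_classical all_reals all_analysis.

Set Implicit Arguments.
Unset Strict Implicit.
Unset Printing Implicit Defensive.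

Import Order.TTheory GRing.Theory Num.Theory.
Import numFieldNormedType.Exports.

Local Open Scope classical_set_scope.
Local Open Scope ring_scope.

Section Hyperbolic.
Context {R : realType}.

Definition cosh (x : R) : R := (expR x + expR (- x)) / 2.
Definition sinh (x : R) : R := (expR x - expR (- x)) / 2.

End Hyperbolic.

Section MarkovProcess.
Context {R : realType} {d' : measure_display} {S : measurableType d'}.

(* Only nonnegative times are meaningful: p t and Z t below are unconstrained
   for t < 0. *)
Definition transition_semigroup (p : R -> R.-pker S ~> S) : Prop :=
  (forall z B, measurable B -> p 0 z B = \d_z B) /\
  (forall (s t : R) z B, 0 <= s -> 0 <= t -> measurable B ->
    p (s + t) z B = (\int[p s z]_y p t y B)%E).

(* L is everywhere defined on bounded measurable functions, and
   (P_t f - f) / t --> L f in sup norm as t decreases to 0. *)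
Definition has_generator (p : R -> R.-pker S ~> S)
    (L : (S -> R) -> S -> R) : Prop :=
  forall f : S -> R, measurable_fun setT f -> bounded_fun f ->
    {uniform, (fun z => ((\int[p t z]_y f y) - f z) / t) @[t --> 0^'+] --> L f}.

Context {d : measure_display} {T : measurableType d}.

Definition natural_filtration (Z : R -> T -> S) (s : R) : set (set T) :=
  <<s \bigcup_(r in [set r | 0 <= r <= s]) g_sigma_algebra_preimage (Z r) >>.

(* Almost every path is right-continuous for the discrete topology on S and has
   left limits in it: a step function with finitely many jumps in each bounded
   time interval. *)
Definition jump_paths (P : probability T R) (Z : R -> T -> S) : Prop :=
  {ae P, forall w,
    (forall t : R, 0 <= t -> \forall s \near t^'+, Z s w = Z t w) /\
    (forall t : R, 0 < t -> exists z, \forall s \near t^'-, Z s w = z)}.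

(* P(Z_(s+t) \in B | Z_r, r <= s) = p_t(Z_s, B) *)
Definition markov_property (P : probability T R) (p : R -> R.-pker S ~> S)
    (Z : R -> T -> S) : Prop :=
  forall (s t : R) A B, 0 <= s -> 0 <= t ->
    natural_filtration Z s A -> measurable B ->
    P (A `&` Z (s + t) @^-1` B) = (\int[P]_(w in A) p t (Z s w) B)%E.

Definition markov_jump_process (P : probability T R)
    (L : (S -> R) -> S -> R) (Z : R -> T -> S) : Prop :=
  [/\ forall t : R, 0 <= t -> measurable_fun setT (Z t),
      jump_paths P Z &
      exists p : R -> R.-pker S ~> S,
        [/\ transition_semigroup p, has_generator p L & markov_property P p Z]].

End MarkovProcess.

(* Z * {-1, 1} with the discrete sigma-algebra. The boolean component encodes
   the velocity, see [velocity]. *)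
Definition rt_state : Type := (int * bool)%type.

HB.instance Definition _ := Choice.on rt_state.
HB.instance Definition _ := isPointed.Build rt_state (0, true).
HB.instance Definition _ := @isMeasurable.Build default_measure_display
  rt_state discrete_measurable discrete_measurable0
  discrete_measurableC discrete_measurableU.

Definition velocity (b : bool) : int := if b then 1 else -1.

Section RunAndTumble.
Context {R : realType}.

Definition rt_generator (lambda kappa gamma : R)
    (f : rt_state -> R) (z : rt_state) : R :=
  let: (x, b) := z in
  lambda * (f (x + velocity b, b) - f (x, b))
  + kappa * (f (x + 1, b) + f (x - 1, b) - 2 * f (x, b))
  + gamma * (f (x, ~~ b) - f (x, b)).

Context {d : measure_display} {T : measurableType d}.

Definition run_and_tumble (lambda kappa gamma : R) (P : probability T R)
    (Z : R -> T -> rt_state) : Prop :=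
  markov_jump_process P (rt_generator lambda kappa gamma) Z.

Definition position (Z : R -> T -> rt_state) (t : R) (w : T) : R :=
  (Z t w).1%:~R.

(* lne is -oo at 0 and +oo at +oo, so that the two bounds in the large deviation
   principle are meaningful for events of probability 0, and convergence of
   log_mgf_rate to a finite limit entails that the expectation is finite for
   large t. *)
Definition log_mgf_rate (P : probability T R) (X : R -> T -> R)
    (alpha t : R) : \bar R :=
  ((t^-1)%:E * lne 'E_P[fun w => expR (alpha * X t w)])%E.

Definition legendre (F : R -> R) (x : R) : \bar R :=
  ereal_sup [set (alpha * x - F alpha)%:E | alpha in [set: R]].

Definition large_deviation_principle (P : probability T R)
    (Y : R -> T -> R) (I : R -> \bar R) : Prop :=
  (forall B : set R, closed B ->
    (limf_esup (fun t : R => (t^-1)%:E * lne (P (Y t @^-1` B))) (pinfty_nbhs R)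
      <= - ereal_inf (I @` B))%E) /\
  (forall G : set R, open G ->
    (- ereal_inf (I @` G)
      <= limf_einf (fun t : R => (t^-1)%:E * lne (P (Y t @^-1` G)))
           (pinfty_nbhs R))%E).

End RunAndTumble.

(* Main.v *)
Require Import Defs.
From mathcomp Require Import all_boot all_order all_algebra.
From mathcomp Require Import all_classical all_reals all_analysis.
From mathcomp Require Import measurable_realfun ring lra.

Import Order.TTheory GRing.Theory Num.Theory.
Import numFieldNormedType.Exports.

Local Open Scope classical_set_scope.
Local Open Scope ring_scope.

(** On functions of the form phi(x, v) = expR (alpha x) h(v) the generator acts
    as a 2 x 2 matrix on h with positive off-diagonal entries [gamma]; its
    larger eigenvalue is F(alpha) and the corresponding vector h is strictly
    positive ([rt_eigenfunctionP], [rt_weight_gt0]).  Hence the mean of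
    phi(Z_t) is expR (F(alpha) t) times the mean of phi(Z_0)
    ([semigroup_rt_eigenfunction]), and since h takes two positive values the
    mean of expR (alpha X_t) is comparable to expR (F(alpha) t) up to constants
    ([rt_moment_bounds]).  This gives the free energy.

    The generator only controls bounded functions, whereas phi is unbounded.
    For bounded f, a pointwise bound L f <= a f integrates to
    P_t f <= expR (a t) f by iterating P_h f <= (1 + a h) f + o(h) with
    h = t / n ([semigroup_supersolution_bounded]), and a lower bound
    L f >= a f - c g integrates in the same way when P_s g is bounded
    ([semigroup_subsolution_bounded]).  These apply to the minima of phi with
    constants n.  Such a minimum is a supersolution because F(alpha) >= 0; it
    fails to be a subsolution only where phi is at least of order n, so the defect is at
    most a multiple of phi^2 / n, and phi^2 is dominated by a multiple of the
    eigenfunction at 2 alpha, whose mean is already bounded.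

    The large deviation principle follows from two-sided bounds on exponential
    moments, by the method of Gärtner and Ellis.  Since F is even, a closed set
    may be replaced by the complement of the open interval of radius its
    distance to 0, and Chernoff's inequality gives the upper bound
    ([ldp_upper]).  For the lower bound at x = F'(alpha), tilting by
    expR (alpha X_t) makes the event that X_t / t is close to x carry almost
    all the mass: the two tails are exponentially smaller, because F is
    differentiable at alpha ([slope_ball_lower], [ldp_lower]).  Every real x is
    a slope of F by the intermediate value theorem, unless
    lambda = kappa = 0; in that case F = 0 and the rate function is infinite
    outside 0 ([rt_free_energy_slopes]). *)

(** * Semigroups of kernels and their generators *)

Lemma semigroup_integral0 {R : realType} {d : measure_display}
    {S : measurableType d} (p : R -> R.-pker S ~> S) (z : S) (f : S -> \bar R) :
  transition_semigroup p -> (forall y, (0 <= f y)%E) -> measurable_fun setT f ->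
  (\int[p 0%R z]_y f y = f z)%E.
Proof.
move=> [p0 _] f0 mf.
rewrite (eq_measure_integral (\d_z : {measure set S -> \bar R})); last first.
  by move=> A mA _; rewrite p0.
by rewrite integral_dirac// diracT mul1e.
Qed.

(** Chapman-Kolmogorov, extended from sets to nonnegative functions. *)
Lemma semigroup_integral {R : realType} {d : measure_display}
    {S : measurableType d} (p : R -> R.-pker S ~> S) (s t : R) (z : S)
    (f : S -> \bar R) :
  transition_semigroup p -> 0 <= s -> 0 <= t ->
  (forall y, (0 <= f y)%E) -> measurable_fun setT f ->
  (\int[p (s + t)%R z]_y f y = \int[p s z]_y \int[p t y]_x f x)%E.
Proof.
move=> [_ ck] s0 t0 f0 mf.
rewrite -(integral_kcomp (p s) (kernel.kernel_snd (p t)))//.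
by apply: eq_measure_integral => A mA _; rewrite ck.
Qed.

Lemma kernel_integrable_bounded {R : realType} {d : measure_display}
    {S : measurableType d} (k : R.-pker S ~> S) (z : S) (f : S -> R) :
  measurable_fun setT f -> bounded_fun f -> (k z).-integrable setT (EFin \o f).
Proof.
move=> mf bf; apply: measurable_bounded_integrable => //.
by rewrite [ltLHS]prob_kernel ltry.
Qed.

Lemma EFin_Rintegral_bounded {R : realType} {d : measure_display}
    {S : measurableType d} (k : R.-pker S ~> S) (z : S) (f : S -> R) :
  measurable_fun setT f -> bounded_fun f ->
  (\int[k z]_y (f y)%:E)%E = (\int[k z]_y f y)%:E.
Proof.
move=> mf bf; rewrite /Rintegral fineK//.
by apply: integrable_fin_num => //; exact: kernel_integrable_bounded.
Qed.

(** Sup-norm convergence of the difference quotients, read as an Euler step whose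
    error is uniform in the starting point.  The uniformity is what allows the
    step to be integrated against the law at an earlier time, hence iterated. *)
Lemma generator_step {R : realType} {d : measure_display} {S : measurableType d}
    (p : R -> R.-pker S ~> S) (L : (S -> R) -> S -> R) (f : S -> R) (e : R) :
  has_generator p L -> measurable_fun setT f -> bounded_fun f -> 0 < e ->
  exists2 d0 : R, 0 < d0 & forall h, 0 < h < d0 -> forall z,
    f z + h * (L f z - e) <= \int[p h z]_y f y <= f z + h * (L f z + e).
Proof.
move=> gen mf bf e0.
suff : \forall h \near 0^'+, forall z,
    f z + h * (L f z - e) <= \int[p h z]_y f y <= f z + h * (L f z + e).
  move=> [d0 /= d00 Hd]; exists d0 => // h /andP[h0 hd].
  by apply: Hd => //=; rewrite sub0r normrN gtr0_norm.
near=> h => z.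
have h0 : 0 < h by near: h; exact: nbhs_right_gt.
have : forall y, `|L f y - (\int[p h y]_x f x - f y) / h| < e.
  near: h; apply: (gen f mf bf [set g : S -> R | forall y, `|L f y - g y| < e]).
  apply/uniform_nbhs; exists [set xy | ball xy.1 e xy.2]; split.
    exact: (entourage_ball _ (PosNum e0)).
  by move=> g /= h y; have := h y Logic.I; rewrite -ball_normE; apply.
move=> /(_ z); rewrite ltr_norml => /andP[].
set I := Rintegral _ _ _ => a b.
have E : (I - f z) / h * h = I - f z by rewrite divfK ?gt_eqF.
by apply/andP; split; nra.
Unshelve. all: by end_near. Qed.

Lemma measurable_fun_Rintegral_kernel {R : realType} {d : measure_display}
    {S : measurableType d} (k : R.-pker S ~> S) (f : S -> R) :
  measurable_fun setT f -> (forall y, 0 <= f y) ->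
  measurable_fun setT (fun y => \int[k y]_x f x).
Proof.
move=> mf f0; apply: measurableT_comp => //.
apply: (measurable_fun_integral_kernel _ (k := EFin \o f)).
- exact: measurable_kernel.
- by move=> y /=; rewrite lee_fin.
- exact/measurable_EFinP.
Qed.

Lemma bounded_fun_Rintegral_kernel {R : realType} {d : measure_display}
    {S : measurableType d} (k : R.-pker S ~> S) (f : S -> R) :
  measurable_fun setT f -> bounded_fun f ->
  bounded_fun (fun y => \int[k y]_x f x).
Proof.
move=> mf bf; have [M [_ Mf]] := bf.
exists (M + 1); split; first exact: num_real.
move=> r Mr y _ /=; apply: (@le_trans _ _ (\int[k y]_x `|f x|)).
  by apply: le_normr_Rintegral => //; exact: kernel_integrable_bounded.
apply: (@le_trans _ _ (\int[k y]_x (M + 1))).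
  apply: le_Rintegral => //.
  - by apply/integrable_norm; exact: kernel_integrable_bounded.
  - apply: kernel_integrable_bounded => //.
    by exists `|M + 1|; split => // s Ms x _ /=; exact: ltW.
  - by move=> x _; apply: Mf => //; rewrite ltrDl.
by rewrite Rintegral_cst// [X in fine X]prob_kernel mulr1 ltW.
Qed.

Lemma semigroup_Rintegral {R : realType} {d : measure_display}
    {S : measurableType d} (p : R -> R.-pker S ~> S) (s t : R) (z : S)
    (f : S -> R) :
  transition_semigroup p -> 0 <= s -> 0 <= t ->
  measurable_fun setT f -> bounded_fun f -> (forall y, 0 <= f y) ->
  \int[p (s + t) z]_y f y = \int[p s z]_y \int[p t y]_x f x.
Proof.
move=> sg s0 t0 mf bf f0; rewrite [LHS]/Rintegral semigroup_integral//.
- rewrite [RHS]/Rintegral; congr fine; apply: eq_integral => y _.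
  exact: EFin_Rintegral_bounded.
- exact/measurable_EFinP.
Qed.

(** * Comparison with an exponential along Euler steps *)

Lemma exprn_le_expR {R : realType} (y : R) n : 0 <= y ->
  (1 + y) ^+ n <= expR (n%:R * y).
Proof.
by move=> y0; rewrite expRM_natl lerXn2r ?nnegrE ?expR_ge0 ?addr_ge0// expR_ge1Dx.
Qed.

(** The quantitative converse of [exprn_le_expR]: with y = a t / n the relative
    error is (a t)^2 / n.  It follows by induction from
    (1 - y^2) expR y <= 1 + y, that is, from 1 - y <= expR (- y). *)
Lemma expR_le_exprn {R : realType} (y : R) n : 0 <= y ->
  (1 - n%:R * y ^+ 2) * expR (n%:R * y) <= (1 + y) ^+ n.
Proof.
move=> y0; elim: n => [|n IH]; first by rewrite !mul0r expr0 expR0 subr0 mulr1.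
have [le0|gt0] := leP (1 - n.+1%:R * y ^+ 2) 0.
  by rewrite (@le_trans _ _ 0)// ?exprn_ge0 ?addr_ge0// mulr_le0_ge0 ?expR_ge0.
have n0 : (0:R) <= n%:R by [].
have ny : n.+1%:R * y ^+ 2 = n%:R * y ^+ 2 + y ^+ 2 by rewrite -natr1 mulrDl mul1r.
have y20 : 0 <= y ^+ 2 by exact: sqr_ge0.
have ny0 : 0 <= n%:R * y ^+ 2 by exact: mulr_ge0.
have y1 : y < 1 by rewrite -(@expr_lt1 _ 2)//; lra.
have ey : (1 - y ^+ 2) * expR y <= 1 + y.
  have := expR_ge1Dx (- y); rewrite expRN => le.
  have e0 := expR_gt0 y.
  have : (1 - y) * expR y <= 1 by rewrite -ler_pdivlMr// mul1r.
  nra.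
have -> : n.+1%:R * y = n%:R * y + y by rewrite -natr1 mulrDl mul1r.
rewrite expRD (exprSr (1 + y)).
apply: (@le_trans _ _ ((1 - n%:R * y ^+ 2) * expR (n%:R * y) * ((1 - y ^+ 2) * expR y))).
  rewrite mulrACA ler_wpM2r ?mulr_ge0 ?expR_ge0//.
  by rewrite ny; nra.
apply: ler_pM => //; rewrite ?mulr_ge0 ?expR_ge0//; lra.
Qed.

Lemma bounded_funZD {R : realType} {S : Type} (f : S -> R) (b c : R) :
  bounded_fun f -> bounded_fun (fun y => b * f y + c).
Proof.
move=> [M [_ Mf]]; exists (`|b| * (M + 1) + `|c|); split; first exact: num_real.
move=> r Mr y _ /=; apply: le_trans (ltW Mr).
rewrite (le_trans (ler_normD _ _))// lerD2r normrM ler_wpM2l//.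
by apply: Mf => //; rewrite ltrDl.
Qed.

Lemma bounded_funZ {R : realType} {S : Type} (f : S -> R) (b : R) :
  bounded_fun f -> bounded_fun (fun y => b * f y).
Proof.
move=> bf; rewrite (_ : (fun y => b * f y) = (fun y => b * f y + 0)).
  exact: bounded_funZD.
by apply/funext => y; rewrite addr0.
Qed.

Lemma kernel_integrable_cst {R : realType} {d : measure_display}
    {S : measurableType d} (k : R.-pker S ~> S) (z : S) (c : R) :
  (k z).-integrable setT (EFin \o cst c).
Proof.
apply: kernel_integrable_bounded => //.
by exists `|c|; split => // r cr y _ /=; exact: ltW.
Qed.

Lemma integrable_EFinD {R : realType} {d : measure_display}
    {S : measurableType d} (mu : {measure set S -> \bar R}) (f g : S -> R) :
  mu.-integrable setT (EFin \o f) -> mu.-integrable setT (EFin \o g) ->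
  mu.-integrable setT (EFin \o (fun y => f y + g y)).
Proof. by move=> fi gi; exact: (integrableD measurableT fi gi). Qed.

(** Meshes finer than any bound; the conclusion for all large n lets several such
    requirements be met at once. *)
Lemma exists_fine_mesh {R : realType} (t r : R) : 0 < r ->
  exists n0 : nat, forall n, (n0 <= n)%N -> t / n.+1%:R < r.
Proof.
move=> r0; exists (Num.truncn (t / r)) => n n0n.
rewrite ltr_pdivrMr// mulrC -ltr_pdivrMr//.
by rewrite (lt_le_trans (truncnS_gt _))// ler_nat ltnS.
Qed.

Section EulerScheme.
Context {R : realType} {d : measure_display} {S : measurableType d}.
Variables (p : R -> R.-pker S ~> S) (L : (S -> R) -> S -> R).
Hypotheses (sg : transition_semigroup p) (gen : has_generator p L).

(** A form of Gronwall's inequality.  With mesh h = t / n, integrating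
    P_h f <= (1 + a h) f + h e against the law at time k h shows by induction
    that P_(k h) f <= (1 + a h)^k (f + k h e).  At k = n this is at most
    expR (a t) (f + t e), and e is arbitrary. *)
Lemma semigroup_supersolution_bounded (a : R) (f : S -> R) (t : R) (z : S) :
  0 <= a -> 0 < t ->
  measurable_fun setT f -> bounded_fun f -> (forall y, 0 <= f y) ->
  (forall y, L f y <= a * f y) ->
  \int[p t z]_y f y <= expR (a * t) * f z.
Proof.
move=> a0 t0 mf bf f0 Lf.
have eat0 := expR_gt0 (a * t).
apply/ler_addgt0Pr => _/posnumP[e].
(* the accumulated error is expR (a t) t e', to be at most e *)
pose e' := e%:num / (expR (a * t) * t).
have e'0 : 0 < e' by rewrite divr_gt0// mulr_gt0.
have [r r0 step] := generator_step p L f e' gen mf bf e'0.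
have [n /(_ n (leqnn n)) nr] := exists_fine_mesh t r r0.
set h := t / n.+1%:R in nr.
have h0 : 0 < h by rewrite divr_gt0.
have hlt : 0 < h < r by rewrite h0.
have ah0 : 0 <= a * h by rewrite mulr_ge0// ltW.
have iter k :
    \int[p (k%:R * h) z]_y f y <= (1 + a * h) ^+ k * (f z + k%:R * h * e').
  elim: k => [|k IH].
    rewrite !mul0r addr0 expr0 mul1r /Rintegral semigroup_integral0//.
    exact/measurable_EFinP.
  rewrite -natr1 (mulrDl _ _ h) mul1r.
  have kh0 : 0 <= k%:R * h by rewrite mulr_ge0// ltW.
  rewrite (semigroup_Rintegral p)//; last exact: ltW.
  apply: (@le_trans _ _ (\int[p (k%:R * h) z]_y ((1 + a * h) * f y + h * e'))).
    apply: le_Rintegral => //.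
    - apply: kernel_integrable_bounded.
        exact: measurable_fun_Rintegral_kernel.
      exact: bounded_fun_Rintegral_kernel.
    - apply: kernel_integrable_bounded; last exact: bounded_funZD.
      by apply: measurable_funD => //; exact: measurable_funM.
    - by move=> y _; have /andP[_] := step h hlt y; have := Lf y; nra.
  rewrite RintegralD//; last 2 first.
  - apply: kernel_integrable_bounded; first exact: measurable_funM.
    exact: bounded_funZ.
  - exact: kernel_integrable_cst.
  rewrite RintegralZl//; last exact: kernel_integrable_bounded.
  rewrite Rintegral_cst// [X in fine X]prob_kernel mulr1.
  rewrite exprS.
  have : 1 <= (1 + a * h) * (1 + a * h) ^+ k.
    by rewrite -exprS exprn_ege1// lerDl.
  move: IH; set I := Rintegral _ _ _; set q := (1 + a * h) ^+ k => IH q1.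
  have he : 0 <= h * e' by rewrite mulr_ge0// ltW.
  have qI : (1 + a * h) * I <= (1 + a * h) * (q * (f z + k%:R * h * e')).
    by rewrite ler_wpM2l// addr_ge0.
  have -> : (1 + a * h) * q * (f z + (k%:R * h + h) * e') =
    (1 + a * h) * (q * (f z + k%:R * h * e')) + (1 + a * h) * q * (h * e').
    by ring.
  by apply: lerD => //; rewrite -[leLHS]mul1r ler_wpM2r.
have ht : n.+1%:R * h = t by rewrite mulrC divfK.
have := iter n.+1; rewrite ht => /le_trans; apply.
have -> : e%:num = expR (a * t) * (t * e').
  by rewrite mulrA mulrC divfK// gt_eqF// mulr_gt0.
rewrite -mulrDr ler_wpM2r ?addr_ge0//.
  by rewrite mulr_ge0 ?ltW.
by have := exprn_le_expR (a * h) n.+1 ah0; rewrite (mulrCA n.+1%:R) ht.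
Qed.

(** The induction of the supersolution case with the inequalities reversed; the
    defect c g contributes at most h c D at each step, where D bounds the means
    of g, so that at most t c D is lost in total. *)
Lemma semigroup_subsolution_bounded (a c D : R) (f g : S -> R) (t : R) (z : S) :
  0 <= a -> 0 <= c -> 0 <= D -> 0 < t ->
  measurable_fun setT f -> bounded_fun f -> (forall y, 0 <= f y) ->
  measurable_fun setT g -> (forall y, 0 <= g y) ->
  (forall y, a * f y - c * g y <= L f y) ->
  (forall s : R, 0 <= s <= t -> (\int[p s z]_y (g y)%:E <= D%:E)%E) ->
  expR (a * t) * (f z - t * c * D) <= \int[p t z]_y f y.
Proof.
move=> a0 c0 D0 t0 mf bf f0 mg g0 Lf gD.
have eat0 := expR_gt0 (a * t).
apply/ler_addgt0Pr => _/posnumP[e].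
pose e' := e%:num / 2 / (expR (a * t) * t).
have e'0 : 0 < e' by rewrite divr_gt0// mulr_gt0.
have [r r0 step] := generator_step p L f e' gen mf bf e'0.
have [n1 n1r] := exists_fine_mesh t r r0.
(* half of e pays for the Euler errors, half for replacing
   (1 + a h) ^+ n by expR (a t); the added 1 keeps the denominator positive *)
pose r' := e%:num / 2 / (t * a ^+ 2 * (expR (a * t) * f z) + 1).
have den0 : 0 < t * a ^+ 2 * (expR (a * t) * f z) + 1.
  by rewrite ltr_wpDl// !mulr_ge0// ltW.
have r'0 : 0 < r' by rewrite divr_gt0.
have [n2 n2r] := exists_fine_mesh t r' r'0.
pose n := maxn n1 n2.
have nr : t / n.+1%:R < r by apply: n1r; exact: leq_maxl.
have nr' : t / n.+1%:R < r' by apply: n2r; exact: leq_maxr.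
set h := t / n.+1%:R in nr nr'.
have h0 : 0 < h by rewrite divr_gt0.
have hlt : 0 < h < r by rewrite h0.
have ah0 : 0 <= a * h by rewrite mulr_ge0// ltW.
have ht : n.+1%:R * h = t by rewrite mulrC divfK.
have gint (s : R) : 0 <= s <= t -> (p s z).-integrable setT (EFin \o g).
  move=> st; apply/integrableP; split; first exact/measurable_EFinP.
  under eq_integral do rewrite /= ger0_norm//.
  by rewrite (le_lt_trans (gD s st))// ltry.
have gR (s : R) : 0 <= s <= t -> \int[p s z]_y g y <= D.
  move=> st; rewrite -lee_fin /Rintegral fineK; first exact: gD.
  by apply: integrable_fin_num => //; exact: gint.
have iter k : (k <= n.+1)%N ->
    (1 + a * h) ^+ k * (f z - k%:R * h * (c * D + e')) <= \int[p (k%:R * h) z]_y f y.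
  elim: k => [_|k IH kn].
    rewrite !mul0r subr0 expr0 mul1r /Rintegral semigroup_integral0//.
    exact/measurable_EFinP.
  have {}IH := IH (ltnW kn).
  rewrite -natr1 (mulrDl _ _ h) mul1r.
  have kh0 : 0 <= k%:R * h by rewrite mulr_ge0// ltW.
  have khn : 0 <= k%:R * h <= t.
    by rewrite kh0 -ht ler_wpM2r ?ltW// ltr_nat.
  rewrite (semigroup_Rintegral p)//; last exact: ltW.
  set I1 := Rintegral _ _ _.
  set I := Rintegral _ _ _ in IH.
  have hcg : (p (k%:R * h) z).-integrable setT
      (EFin \o (fun y => h * c * g y + h * e')).
    apply: integrable_EFinD.
    - exact: (integrableZl measurableT (h * c) (gint _ khn)).
    - exact: kernel_integrable_cst.
  have Pfi : (p (k%:R * h) z).-integrable setT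
      (EFin \o (fun y => \int[p h y]_x f x)).
    apply: kernel_integrable_bounded.
      exact: measurable_fun_Rintegral_kernel.
    exact: bounded_fun_Rintegral_kernel.
  have : (1 + a * h) * I <= I1 + h * (c * \int[p (k%:R * h) z]_y g y + e').
    rewrite -[(1 + a * h) * I]RintegralZl//; last exact: kernel_integrable_bounded.
    have -> : h * (c * \int[p (k%:R * h) z]_y g y + e') =
        \int[p (k%:R * h) z]_y (h * c * g y + h * e').
      rewrite RintegralD//.
      - rewrite RintegralZl//; last exact: gint.
        by rewrite Rintegral_cst// [X in fine X]prob_kernel mulr1; ring.
      - exact: (integrableZl measurableT (h * c) (gint _ khn)).
      - exact: kernel_integrable_cst.
    rewrite -RintegralD//.
    apply: le_Rintegral => //.
    - apply: kernel_integrable_bounded; first exact: measurable_funM.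
      exact: bounded_funZ.
    - exact: (integrable_EFinD _ _ _ Pfi hcg).
    - by move=> y _; have /andP[+ _] := step h hlt y; have := Lf y; nra.
  rewrite exprS.
  have : 1 <= (1 + a * h) * (1 + a * h) ^+ k.
    by rewrite -exprS exprn_ege1// lerDl.
  move: IH (gR _ khn); set q := (1 + a * h) ^+ k; set G := Rintegral _ _ _.
  move=> IH GD q1 hI.
  have hE : h * (c * G + e') <= h * (c * D + e').
    by apply: ler_wpM2l; [exact: ltW|rewrite lerD2r ler_wpM2l].
  have hE0 : 0 <= h * (c * D + e').
    by apply: mulr_ge0; [exact: ltW|apply: addr_ge0; [exact: mulr_ge0|exact: ltW]].
  have qI : (1 + a * h) * (q * (f z - k%:R * h * (c * D + e'))) <= (1 + a * h) * I.
    by rewrite ler_wpM2l// addr_ge0.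
  have -> : (1 + a * h) * q * (f z - (k%:R * h + h) * (c * D + e')) =
    (1 + a * h) * (q * (f z - k%:R * h * (c * D + e'))) -
    (1 + a * h) * q * (h * (c * D + e')) by ring.
  have : h * (c * D + e') <= (1 + a * h) * q * (h * (c * D + e')).
    by rewrite -[leLHS]mul1r ler_wpM2r.
  lra.
have := iter n.+1 (leqnn _); rewrite ht; set I := Rintegral _ _ _.
have /= up := exprn_le_expR (a * h) n.+1 ah0.
have /= lo := expR_le_exprn (a * h) n.+1 ah0.
rewrite (mulrCA n.+1%:R) ht in up lo.
set q := (1 + a * h) ^+ n.+1 in up lo *.
move=> hI.
have e2 : expR (a * t) * t * e' = e%:num / 2.
  by rewrite mulrC divfK// gt_eqF// mulr_gt0.
have r2 : h * (t * a ^+ 2 * (expR (a * t) * f z)) <= e%:num / 2.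
  have : r' * (t * a ^+ 2 * (expR (a * t) * f z) + 1) = e%:num / 2.
    by rewrite divfK// gt_eqF.
  have A0 : 0 <= t * a ^+ 2 * (expR (a * t) * f z) by rewrite !mulr_ge0// ltW.
  by nra.
have lo' : expR (a * t) * f z - h * (t * a ^+ 2 * (expR (a * t) * f z)) <= q * f z.
  apply: (@le_trans _ _ ((1 - n.+1%:R * (a * h) ^+ 2) * expR (a * t) * f z)).
    have E2 : n.+1%:R * (a * h) ^+ 2 = n.+1%:R * h * (h * a ^+ 2) by ring.
    by rewrite E2 ht le_eqVlt; apply/orP; left; apply/eqP; ring.
  by rewrite ler_wpM2r.
have up' : q * (t * (c * D + e')) <= expR (a * t) * (t * (c * D + e')).
  apply: ler_wpM2r => //; apply: mulr_ge0; first exact: ltW.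
  by apply: addr_ge0; [exact: mulr_ge0|exact: ltW].
lra.
Qed.
End EulerScheme.

(** * Unbounded functions by truncation *)

(** Truncating from above preserves supersolutions, as a minimum of two
    supersolutions is one. *)
Definition trunc_fun {R : realType} {S : Type} (g : S -> R) (n : nat) : S -> R :=
  fun y => Num.min (g y) n%:R.

Section Truncation.
Context {R : realType} {d : measure_display} {S : measurableType d}.
Variable g : S -> R.
Hypotheses (mg : measurable_fun setT g) (g0 : forall y, 0 <= g y).

Lemma measurable_trunc_fun n : measurable_fun setT (trunc_fun g n).
Proof. exact: measurable_minr. Qed.

Lemma trunc_fun_ge0 n y : 0 <= trunc_fun g n y.
Proof. by rewrite /trunc_fun le_min g0 ler0n. Qed.

Lemma bounded_trunc_fun n : bounded_fun (trunc_fun g n).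
Proof.
exists n%:R; split; first exact: num_real.
move=> r nr y _ /=; rewrite ger0_norm ?trunc_fun_ge0//.
by rewrite (le_trans _ (ltW nr))// /trunc_fun ge_min lexx orbT.
Qed.

Variables (p : R -> R.-pker S ~> S) (L : (S -> R) -> S -> R).
Hypotheses (sg : transition_semigroup p) (gen : has_generator p L).

(** The bounds for the truncations pass to the limit by monotone convergence. *)
Lemma semigroup_supersolution (a t : R) (z : S) : 0 <= a -> 0 <= t ->
  (forall n y, L (trunc_fun g n) y <= a * trunc_fun g n y) ->
  (\int[p t z]_y (g y)%:E <= (expR (a * t) * g z)%:E)%E.
Proof.
move=> a0; rewrite le_eqVlt => /predU1P[<-|t0] Lg.
  rewrite (semigroup_integral0 p z (EFin \o g))//=.
  - by rewrite mulr0 expR0 mul1r.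
  - exact/measurable_EFinP.
pose f n y := (trunc_fun g n y)%:E.
have cf y : (f ^~ y) n @[n --> \oo] --> (g y)%:E.
  apply: cvg_near_cst; exists (Num.truncn (g y)).+1 => //= n /= nn.
  rewrite /f /trunc_fun min_l// ltW// (lt_le_trans (truncnS_gt _))//.
  by rewrite ler_nat.
have cvI : (\int[p t z]_y f n y @[n --> \oo] --> \int[p t z]_y (g y)%:E)%E.
  have <- : (\int[p t z]_y (limn (f ^~ y)) = \int[p t z]_y (g y)%:E)%E.
    by apply: eq_integral => y _; apply/cvg_lim => //; exact: cf.
  apply: cvg_monotone_convergence => //.
  - by move=> n; apply/measurable_EFinP; exact: measurable_trunc_fun.
  - by move=> n y _; rewrite lee_fin trunc_fun_ge0.
  - move=> y _ m n mn; rewrite /f /trunc_fun lee_fin.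
    rewrite le_min ge_min lexx/= ge_min ler_nat mn orbT//.
apply: (cvge_le _ cvI) => //; apply: nearW => n.
rewrite (EFin_Rintegral_bounded _ _ _ (measurable_trunc_fun n) (bounded_trunc_fun n)).
rewrite lee_fin (le_trans (semigroup_supersolution_bounded p L sg gen a _ t z a0 t0
  (measurable_trunc_fun n) (bounded_trunc_fun n) (trunc_fun_ge0 n) (Lg n)))//.
by rewrite ler_wpM2l ?expR_ge0// /trunc_fun ge_min lexx.
Qed.

(** The defect c / n of the truncation at level n vanishes in the limit, while
    the truncation itself agrees with g at the point z for n large. *)
Lemma semigroup_subsolution (g2 : S -> R) (a c D t : R) (z : S) :
  0 <= a -> 0 <= c -> 0 <= D -> 0 < t ->
  measurable_fun setT g2 -> (forall y, 0 <= g2 y) ->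
  (forall n y, a * trunc_fun g n.+1 y - c / n.+1%:R * g2 y <=
     L (trunc_fun g n.+1) y) ->
  (forall s : R, 0 <= s <= t -> (\int[p s z]_y (g2 y)%:E <= D%:E)%E) ->
  ((expR (a * t) * g z)%:E <= \int[p t z]_y (g y)%:E)%E.
Proof.
move=> a0 c0 D0 t0 mg2 g20 Lg gD.
apply/lee_addgt0Pr => _/posnumP[e].
have [n0 n0e] := exists_fine_mesh (expR (a * t) * (t * c * D)) e%:num [gt0 of e%:num].
pose n := maxn n0 (Num.truncn (g z)).
have ne := n0e n (leq_maxl _ _).
have gn : trunc_fun g n.+1 z = g z.
  rewrite /trunc_fun min_l// ltW// (lt_le_trans (truncnS_gt _))//.
  by rewrite ler_nat ltnS leq_maxr.
have := semigroup_subsolution_bounded p L sg gen a (c / n.+1%:R) D _ g2 t z a0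
  (divr_ge0 c0 (ler0n _ _)) D0 t0 (measurable_trunc_fun n.+1)
  (bounded_trunc_fun n.+1) (trunc_fun_ge0 n.+1) mg2 g20 (Lg n) gD.
rewrite gn -lee_fin.
rewrite -(EFin_Rintegral_bounded _ _ _ (measurable_trunc_fun n.+1)
  (bounded_trunc_fun n.+1)).
move=> le.
apply: (@le_trans _ _ ((expR (a * t) * (g z - t * (c / n.+1%:R) * D))%:E + e%:num%:E)%E).
  rewrite -EFinD lee_fin -lerBlDl.
  by rewrite (le_trans _ (ltW ne))// le_eqVlt; apply/orP; left; apply/eqP; ring.
apply: leeD => //; apply: le_trans le _; apply: ge0_le_integral => //.
- by move=> y _; rewrite lee_fin trunc_fun_ge0.
- by apply/measurable_EFinP; exact: measurable_trunc_fun.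
- exact/measurable_EFinP.
- by move=> y _; rewrite lee_fin /trunc_fun ge_min lexx.
Qed.

End Truncation.

(** * Hyperbolic functions *)

Section HyperbolicFunctions.
Context {R : realType}.

Lemma cosh_ge1 (alpha : R) : 1 <= cosh alpha.
Proof.
rewrite /cosh ler_pdivlMr// mul1r.
have := expR_ge1Dx alpha; have := expR_ge1Dx (- alpha); lra.
Qed.

Lemma is_derive_cosh (a : R) : is_derive a 1 (@cosh R) (sinh a).
Proof.
rewrite /cosh; apply: is_derive_eq.
by rewrite /sinh /GRing.scale /=; ring.
Qed.

Lemma is_derive_sinh (a : R) : is_derive a 1 (@sinh R) (cosh a).
Proof.
rewrite /sinh; apply: is_derive_eq.
by rewrite /cosh /GRing.scale /=; ring.
Qed.

Lemma coshN (a : R) : cosh (- a) = cosh a.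
Proof. by rewrite /cosh opprK addrC. Qed.

Lemma sinhN (a : R) : sinh (- a) = - sinh a.
Proof. by rewrite /sinh opprK -mulNr opprB. Qed.

Lemma sinh_ge (a : R) : 0 <= a -> a / 2 <= sinh a.
Proof.
move=> a0; rewrite /sinh ler_pM2r ?invr_gt0//.
have := expR_ge1Dx a; have : expR (- a) <= 1 by rewrite -expR0 ler_expR oppr_le0.
lra.
Qed.

End HyperbolicFunctions.

(** * The run-and-tumble generator and its eigenfunctions *)

Lemma measurable_rt_state {R : realType} (f : rt_state -> R) :
  measurable_fun setT f.
Proof. by move=> _ B mB; exact: Logic.I. Qed.

Section RunAndTumbleGenerator.
Context {R : realType}.
Variables lambda kappa gamma : R.
Hypotheses (lambda_ge0 : 0 <= lambda) (kappa_ge0 : 0 <= kappa)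
  (gamma_gt0 : 0 < gamma).

Local Notation L := (rt_generator lambda kappa gamma).

(** Below level n the generator sees the true value at the current state and
    smaller values at the neighbours; above it the truncation is maximal, so the
    generator is nonpositive, while the right-hand side is nonnegative. *)
Lemma rt_generator_trunc_le (g : rt_state -> R) (a : R) n :
  (forall z, 0 <= g z) -> 0 <= a -> (forall z, L g z <= a * g z) ->
  forall z, L (trunc_fun g n) z <= a * trunc_fun g n z.
Proof.
move=> g0 a0 Lg z; have gamma_ge0 : 0 <= gamma by exact: ltW.
have ming y : trunc_fun g n y <= g y by rewrite /trunc_fun ge_min lexx.
have minn y : trunc_fun g n y <= n%:R by rewrite /trunc_fun ge_min lexx orbT.
have := trunc_fun_ge0 g g0 n z.
have := Lg z; case: z => x b; rewrite /rt_generator.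
have g1 := ming (x + velocity b, b); have n1 := minn (x + velocity b, b).
have g2 := ming (x + 1, b); have n2 := minn (x + 1, b).
have g3 := ming (x - 1, b); have n3 := minn (x - 1, b).
have g4 := ming (x, ~~ b); have n4 := minn (x, ~~ b).
have [gn|ng] := leP (g (x, b)) n%:R.
  have -> : trunc_fun g n (x, b) = g (x, b) by rewrite /trunc_fun min_l.
  move=> le _; apply: le_trans le.
  by apply: lerD; [apply: lerD|]; apply: ler_wpM2l => //; lra.
have -> : trunc_fun g n (x, b) = n%:R by rewrite /trunc_fun min_r// ltW.
move=> _ tn; apply: (@le_trans _ _ 0); last exact: mulr_ge0.
rewrite -oppr_ge0 !opprD -!mulrN; apply: addr_ge0; [apply: addr_ge0|];
  apply: mulr_ge0 => //; lra.
Qed.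

(** If K g z <= n then the truncation equals g at z and at all neighbours.
    Otherwise g z <= K / n g z ^+ 2, and the generator is at least minus the
    total jump rate times the truncated value. *)
Lemma rt_generator_trunc_ge (g g2 : rt_state -> R) (a K : R) n :
  (forall z, 0 <= g z) -> 0 <= a -> 1 <= K ->
  (forall z, L g z = a * g z) ->
  (forall x b, [/\ g (x + 1, b) <= K * g (x, b), g (x - 1, b) <= K * g (x, b)
     & g (x, ~~ b) <= K * g (x, b)]) ->
  (forall z, g z ^+ 2 <= g2 z) ->
  forall z, a * trunc_fun g n.+1 z
     - K * (a + lambda + 2 * kappa + gamma) / n.+1%:R * g2 z <=
    L (trunc_fun g n.+1) z.
Proof.
move=> g0 a0 K1 Lg gK gg2 z.
have n0 : 0 < n.+1%:R :> R by [].
set c := a + lambda + 2 * kappa + gamma.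
have c0 : 0 <= c.
  by rewrite !addr_ge0//; [exact: mulr_ge0|exact: ltW].
have g20 : 0 <= g2 z by apply: le_trans (gg2 z); exact: sqr_ge0.
have [Kg|Kg] := leP (K * g z) n.+1%:R.
  have tE y : g y <= K * g z -> trunc_fun g n.+1 y = g y.
    by move=> gy; rewrite /trunc_fun min_l// (le_trans gy).
  have -> : L (trunc_fun g n.+1) z = a * trunc_fun g n.+1 z.
    have := Lg z; case: z Kg tE {g20} => x b Kg tE; rewrite /rt_generator.
    have [gp gm gf] := gK x b.
    have gz : g (x, b) <= K * g (x, b) by rewrite ler_peMl.
    rewrite (tE (x, b))// (tE (x + 1, b))// (tE (x - 1, b))// (tE (x, ~~ b))//.
    by rewrite (tE (x + velocity b, b))//; case: (b) gp gm.
  by rewrite gerBl// mulr_ge0// divr_ge0// mulr_ge0// (le_trans _ K1).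
have t0 y := trunc_fun_ge0 g g0 n.+1 y.
have tg : trunc_fun g n.+1 z <= K / n.+1%:R * g2 z.
  apply: (@le_trans _ _ (g z)); first by rewrite /trunc_fun ge_min lexx.
  apply: (@le_trans _ _ (K / n.+1%:R * g z ^+ 2)).
    rewrite expr2 mulrA -[leLHS]mul1r ler_wpM2r// mulrAC ler_pdivlMr// mul1r.
    exact: ltW.
  by rewrite ler_wpM2l// divr_ge0// (le_trans _ K1).
have : - (c - a) * trunc_fun g n.+1 z <= L (trunc_fun g n.+1) z.
  case: z {g20 Kg tg} => x b; rewrite /rt_generator /c.
  set t := trunc_fun g n.+1.
  have h1 : 0 <= lambda * t (x + velocity b, b) by exact: mulr_ge0.
  have h2 : 0 <= kappa * t (x + 1, b) by exact: mulr_ge0.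
  have h3 : 0 <= kappa * t (x - 1, b) by exact: mulr_ge0.
  have h4 : 0 <= gamma * t (x, ~~ b) by apply: mulr_ge0 => //; exact: ltW.
  lra.
have : c * trunc_fun g n.+1 z <= c * (K / n.+1%:R * g2 z) by rewrite ler_wpM2l.
have -> : K * c / n.+1%:R * g2 z = c * (K / n.+1%:R * g2 z) by ring.
move: (L _ _) (K / n.+1%:R * g2 z) (trunc_fun _ _ _) => l k u; rewrite mulNr mulrBl.
lra.
Qed.

Definition rt_free_energy (alpha : R) : R :=
  (2 * kappa + lambda) * (cosh alpha - 1)
    + Num.sqrt (gamma ^+ 2 + lambda ^+ 2 * sinh alpha ^+ 2) - gamma.

(** The positive eigenvector, for the eigenvalue F(alpha), of the matrix by which
    the generator acts on functions expR (alpha x) h(v). *)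
Definition rt_weight (alpha : R) (b : bool) : R :=
  if b then gamma
  else Num.sqrt (gamma ^+ 2 + lambda ^+ 2 * sinh alpha ^+ 2)
       - lambda * sinh alpha.

Definition rt_eigenfunction (alpha : R) (z : rt_state) : R :=
  expR (alpha * z.1%:~R) * rt_weight alpha z.2.

Lemma rt_discriminant_gt0 (alpha : R) :
  0 < gamma ^+ 2 + lambda ^+ 2 * sinh alpha ^+ 2.
Proof. by rewrite ltr_pwDl ?exprn_gt0// -exprMn sqr_ge0. Qed.

(** Strict because gamma > 0: velocity flips are what makes both components of
    the eigenvector positive. *)
Lemma rt_sqrt_gt (alpha : R) :
  `|lambda * sinh alpha| <
  Num.sqrt (gamma ^+ 2 + lambda ^+ 2 * sinh alpha ^+ 2).
Proof.
rewrite -sqrtr_sqr ltr_sqrt; last exact: rt_discriminant_gt0.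
by rewrite exprMn ltrDr exprn_gt0.
Qed.

Lemma rt_weight_gt0 (alpha : R) b : 0 < rt_weight alpha b.
Proof.
case: b => //=; rewrite subr_gt0; apply: le_lt_trans (rt_sqrt_gt alpha).
exact: ler_norm.
Qed.

Lemma rt_eigenfunction_gt0 (alpha : R) z : 0 < rt_eigenfunction alpha z.
Proof. by rewrite mulr_gt0 ?expR_gt0 ?rt_weight_gt0. Qed.

Lemma rt_free_energy_ge0 (alpha : R) : 0 <= rt_free_energy alpha.
Proof.
rewrite /rt_free_energy -addrA addr_ge0//.
  by rewrite mulr_ge0 ?subr_ge0 ?cosh_ge1// addr_ge0// mulr_ge0.
rewrite subr_ge0 -[leLHS](ger0_norm (ltW gamma_gt0)) -sqrtr_sqr ler_wsqrtr//.
by rewrite lerDl mulr_ge0 ?sqr_ge0.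
Qed.

(** For v = 1 the equation is linear and the weights are chosen to satisfy it;
    for v = -1 it is the characteristic equation, that is,
    gamma^2 = (s - lambda sinh alpha) (s + lambda sinh alpha)
    with s the square root in F. *)
Lemma rt_eigenfunctionP (alpha : R) z :
  L (rt_eigenfunction alpha) z =
  rt_free_energy alpha * rt_eigenfunction alpha z.
Proof.
case: z => x b; rewrite /rt_generator /rt_eigenfunction /=.
have shift (n : int) :
    expR (alpha * (x + n)%:~R) = expR (alpha * x%:~R) * expR (alpha * n%:~R).
  by rewrite intrD mulrDr expRD.
rewrite !shift mulrN1 mulr1 /rt_free_energy /rt_weight.
set s := Num.sqrt _.
have s2 : s ^+ 2 = gamma ^+ 2 + lambda ^+ 2 * sinh alpha ^+ 2.
  by rewrite sqr_sqrtr// ltW// rt_discriminant_gt0.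
move: s2; rewrite /cosh /sinh.
set e := expR (alpha * x%:~R); set u := expR alpha; set v := expR (- alpha).
case: b => /= s2; rewrite ?mulrN1 ?mulr1 -/u -/v.
  by field.
set w := s - lambda * ((u - v) / 2).
have g2 : gamma ^+ 2 = w * (s + lambda * ((u - v) / 2)).
  rewrite /w -[LHS](addrK (lambda ^+ 2 * ((u - v) / 2) ^+ 2)) -s2; ring.
have -> : gamma * (e * gamma - e * w) = e * (gamma ^+ 2 - gamma * w) by ring.
by rewrite g2; field.
Qed.
End RunAndTumbleGenerator.

(** * Exponential moments of the process *)

Section RunAndTumbleMoments.
Context {R : realType}.
Variables lambda kappa gamma : R.
Hypotheses (lambda_ge0 : 0 <= lambda) (kappa_ge0 : 0 <= kappa)
  (gamma_gt0 : 0 < gamma).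

Local Notation F := (rt_free_energy lambda kappa gamma).
Local Notation w := (rt_weight lambda gamma).
Local Notation phi := (rt_eigenfunction lambda gamma).

(** An exponential varies by bounded factors between neighbouring states. *)
Lemma rt_eigenfunction_neighbour (alpha : R) :
  exists2 K : R, 1 <= K & forall x b,
    [/\ phi alpha (x + 1, b) <= K * phi alpha (x, b),
        phi alpha (x - 1, b) <= K * phi alpha (x, b)
      & phi alpha (x, ~~ b) <= K * phi alpha (x, b)].
Proof.
have wgt0 b : 0 < w alpha b by exact: rt_weight_gt0.
pose K := 1 + expR alpha + expR (- alpha)
  + w alpha true / w alpha false + w alpha false / w alpha true.
have ea := expR_gt0 alpha; have eNa := expR_gt0 (- alpha).
have wtf : 0 < w alpha true / w alpha false by exact: divr_gt0.
have wft : 0 < w alpha false / w alpha true by exact: divr_gt0.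
exists K; first by rewrite /K; lra.
move=> x b; rewrite /rt_eigenfunction /= !intrD !mulrDr !expRD mulrN1 mulr1.
rewrite ![_ * expR (_ alpha)]mulrC -!mulrA mulrCA.
have e0 : 0 <= expR (alpha * x%:~R) * w alpha b by rewrite mulr_ge0 ?expR_ge0 ?ltW.
split.
- by rewrite mulrCA ler_wpM2r// /K; lra.
- by rewrite ler_wpM2r// /K; lra.
rewrite mulrCA ler_wpM2l ?expR_ge0// -ler_pdivrMr//.
have Kt : w alpha true / w alpha false <= K by rewrite /K; lra.
have Kf : w alpha false / w alpha true <= K by rewrite /K; lra.
by case: b {e0}.
Qed.

(** Squaring doubles the exponent, and the two velocities only change the
    constant.  This provides the integrable majorant of the truncation defect. *)
Lemma rt_eigenfunction_sqr_le (alpha : R) :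
  exists2 c : R, 0 <= c & forall z, phi alpha z ^+ 2 <= c * phi (2 * alpha) z.
Proof.
have w0 a b : 0 < w a b by exact: rt_weight_gt0.
pose r b := w alpha b ^+ 2 / w (2 * alpha) b.
have r0 b : 0 <= r b by rewrite divr_ge0 ?sqr_ge0 ?ltW.
exists (r true + r false); first exact: addr_ge0.
move=> [x b]; rewrite /rt_eigenfunction /= exprMn -mulrA expRM_natl.
rewrite (mulrCA (_ + _)) ler_wpM2l ?sqr_ge0// -ler_pdivrMr// -/(r b).
by case: b; rewrite ?lerDl ?lerDr.
Qed.

Section Semigroup.
Variable p : R -> R.-pker rt_state ~> rt_state.
Hypotheses (sg : transition_semigroup p)
  (gen : has_generator p (rt_generator lambda kappa gamma)).

(** The upper bound holds for every supersolution; applied at 2 alpha it bounds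
    the means of phi^2, which control the truncation defect in the lower bound. *)
Lemma semigroup_rt_eigenfunction (alpha t : R) z : 0 < t ->
  (\int[p t z]_y (phi alpha y)%:E = (expR (F alpha * t) * phi alpha z)%:E)%E.
Proof.
move=> t0.
have phi0 a y : 0 <= phi a y by apply: ltW; exact: rt_eigenfunction_gt0.
have F0 a : 0 <= F a by exact: rt_free_energy_ge0.
have Lphi a y : rt_generator lambda kappa gamma (phi a) y = F a * phi a y.
  exact: rt_eigenfunctionP.
apply/eqP; rewrite eq_le; apply/andP; split.
  apply: (semigroup_supersolution _ (measurable_rt_state _) _ _ _ sg gen) => //.
    exact: ltW.
  by move=> n y; apply: rt_generator_trunc_le => // z'; rewrite Lphi.
have [K K1 phiK] := rt_eigenfunction_neighbour alpha.
have [c c0 phi2] := rt_eigenfunction_sqr_le alpha.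
pose g2 y := c * phi (2 * alpha) y.
have g20 y : 0 <= g2 y by exact: mulr_ge0.
have Lg2 y : rt_generator lambda kappa gamma g2 y = F (2 * alpha) * g2 y.
  rewrite /g2 mulrCA -Lphi; case: (y) => x b; rewrite /rt_generator; ring.
apply: (@semigroup_subsolution _ _ _ _ (measurable_rt_state _) _ _ _ sg gen g2 _
  (K * (F alpha + lambda + 2 * kappa + gamma))
  (expR (F (2 * alpha) * t) * g2 z)) => //.
- have gamma_ge0 := ltW gamma_gt0.
  apply: mulr_ge0; first exact: le_trans K1.
  by do 3?[apply: addr_ge0 => //]; exact: mulr_ge0.
- by rewrite mulr_ge0 ?expR_ge0.
- by move=> n; apply: rt_generator_trunc_ge.
move=> s /andP[s0 st].
apply: (@le_trans _ _ (expR (F (2 * alpha) * s) * g2 z)%:E).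
  apply: (semigroup_supersolution _ (measurable_rt_state _) _ _ _ sg gen) => //.
  by move=> n y; apply: rt_generator_trunc_le => // z'; rewrite Lg2.
by rewrite lee_fin ler_wpM2r// ler_expR ler_wpM2l.
Qed.

End Semigroup.

End RunAndTumbleMoments.

Section RunAndTumbleProcess.
Context {R : realType}.
Variables lambda kappa gamma : R.
Hypotheses (lambda_ge0 : 0 <= lambda) (kappa_ge0 : 0 <= kappa)
  (gamma_gt0 : 0 < gamma).
Context {d : measure_display} {T : measurableType d}.
Variables (P : probability T R) (Z : R -> T -> rt_state).
Hypotheses (Z_rt : run_and_tumble lambda kappa gamma P Z)
  (Z_init : forall b : bool, P [set w | Z 0 w = (0, b)] = (2^-1)%:E).

Local Notation F := (rt_free_energy lambda kappa gamma).
Local Notation wt := (rt_weight lambda gamma).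
Local Notation phi := (rt_eigenfunction lambda gamma).

Lemma measurable_rt_process t : 0 <= t -> measurable_fun setT (Z t).
Proof. by case: Z_rt => mZ _ _; exact: mZ. Qed.

Lemma measurable_rt_process_comp {d' : measure_display} {U : measurableType d'}
  t (f : rt_state -> U) : 0 <= t -> measurable_fun setT (f \o Z t).
Proof.
move=> t0; apply: measurableT_comp; last exact: measurable_rt_process.
by move=> _ B mB; exact: Logic.I.
Qed.

(** The two initial states carry the whole mass, so the remaining event is
    negligible. *)
Lemma integral_initial_state (h : rt_state -> \bar R) : (forall z, 0 <= h z)%E ->
  (\int[P]_w h (Z 0%R w) =
   (2^-1)%:E * h (0%R, true) + (2^-1)%:E * h (0%R, false))%E.
Proof.
move=> h0.
pose A b := [set w | Z 0 w = (0, b)].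
have mA b : measurable (A b).
  rewrite -[A b]setTI; apply: (measurable_rt_process 0 (lexx _) measurableT [set (0, b)]).
  exact: Logic.I.
have PA b : P (A b) = (2^-1)%:E by exact: Z_init.
have dA : [disjoint A true & A false].
  by apply/disj_set2P/seteqP; split => // w []; rewrite /A /= => ->.
have mh D : measurable_fun D (fun w => h (Z 0 w)).
  apply: measurable_funTS; exact: (measurable_rt_process_comp 0 h).
have mU : measurable (A true `|` A false) by exact: measurableU.
have PU : P (A true `|` A false) = 1%E.
  transitivity (P (A true) + P (A false))%E.
    by rewrite -measureU//; exact/disj_set2P.
  by rewrite !PA -EFinD -[2^-1]mul1r -splitr.
have intA b : (\int[P]_(w in A b) h (Z 0%R w) = (2^-1)%:E * h (0%R, b))%E.
  rewrite -(PA b) muleC -integral_cst//; apply: eq_integral => w.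
  by rewrite inE => wA; congr h.
have PN : P (~` (A true `|` A false)) = 0%E.
  by rewrite probability_setC// PU subee.
rewrite -[X in integral _ X _](setUv (A true `|` A false)).
rewrite ge0_integral_setU//; last 2 first.
- exact: measurableC.
- by apply/disj_set2P; rewrite setICr.
rewrite [X in (_ + X)%E]null_set_integral ?adde0//; last exact: measurableC.
by rewrite ge0_integral_setU// !intA.
Qed.

(** The Markov property at time 0 on the sure event. *)
Lemma rt_law : exists p : R -> R.-pker rt_state ~> rt_state,
  [/\ transition_semigroup p,
      has_generator p (rt_generator lambda kappa gamma) &
      forall t (f : rt_state -> \bar R), 0 <= t -> (forall z, 0 <= f z)%E ->
      (\int[P]_w f (Z t w) = (2^-1)%:E * \int[p t (0%R, true)]_z f z
         + (2^-1)%:E * \int[p t (0%R, false)]_z f z)%E].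
Proof.
have [_ _ [p [sg gen mk]]] := Z_rt.
exists p; split=> // t f t0 f0.
have mf : measurable_fun setT f by move=> _ B mB; exact: Logic.I.
have h0 : 0 <= 2^-1 :> R by [].
pose half := NngNum h0.
pose nu := mscale half (measure_add (p t (0, true)) (p t (0, false))).
have law B : P (Z t @^-1` B) = nu B.
  have := mk 0 t setT B (lexx _) t0.
  rewrite setTI add0r => -> //; last exact: (@measurableT _ (g_sigma_algebraType _)).
  rewrite (integral_initial_state (fun z => p t z B))//.
  rewrite -muleDr//; last by rewrite ge0_adde_def// inE.
  by rewrite -measure_addE.
transitivity (\int[nu]_z f z)%E.
  have := ge0_integral_pushforward (measurable_rt_process t t0) P measurableT mf.
  rewrite preimage_setT => <-; last by [].
  apply: eq_measure_integral; first exact: measurable_rt_process.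
  by move=> mZt B mB _; exact: law.
rewrite /nu ge0_integral_mscale// ge0_integral_measure_add//= muleDr//.
by rewrite ge0_adde_def// inE; apply: integral_ge0.
Qed.

(** The weights take only two values, so expR (alpha X_t) and the eigenfunction
    at Z_t differ by bounded factors. *)
Lemma rt_moment_bounds (alpha : R) : exists c C : R, [/\ 0 < c, 0 < C &
  forall t, 0 < t ->
   ((c * expR (F alpha * t))%:E <= 'E_P[fun w => expR (alpha * position Z t w)]
    <= (C * expR (F alpha * t))%:E)%E].
Proof.
have [p [sg gen law]] := rt_law.
have w0 b : 0 < wt alpha b by exact: rt_weight_gt0.
pose s := wt alpha true + wt alpha false.
pose r := (wt alpha true)^-1 + (wt alpha false)^-1.
have s0 : 0 < s by exact: addr_gt0.
have r0 : 0 < r by rewrite addr_gt0// invr_gt0.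
(* s / 2 is the initial mean of the eigenfunction; s bounds the weights and r
   their inverses *)
exists (s^-1 * (s / 2)), (r * (s / 2)); split.
- by rewrite mulr_gt0 ?invr_gt0// divr_gt0.
- by rewrite mulr_gt0 ?invr_gt0// divr_gt0.
move=> t t0.
have phi0 z : 0 <= phi alpha z by apply: ltW; exact: rt_eigenfunction_gt0.
have phi_init b : phi alpha (0, b) = wt alpha b.
  by rewrite /rt_eigenfunction mulr0 expR0 mul1r.
have Ephi : (\int[P]_w (phi alpha (Z t w))%:E = (s / 2 * expR (F alpha * t))%:E)%E.
  rewrite (law t (EFin \o phi alpha) (ltW t0))//.
  rewrite !(semigroup_rt_eigenfunction _ _ _ lambda_ge0 kappa_ge0 gamma_gt0 p sg gen)//.
  by rewrite !phi_init -!EFinM -EFinD /s; congr EFin; field.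
have mphi : measurable_fun setT (fun w => (phi alpha (Z t w))%:E).
  by apply/measurable_EFinP; apply: measurable_rt_process_comp; exact: ltW.
have mE : measurable_fun setT (fun w => (expR (alpha * position Z t w))%:E).
  apply/measurable_EFinP.
  by apply: (measurable_rt_process_comp t (fun z => expR (alpha * z.1%:~R))); exact: ltW.
rewrite unlock -(mulrA s^-1) -(mulrA r) (EFinM s^-1) (EFinM r) -Ephi; apply/andP; split.
- rewrite -ge0_integralZl_EFin//; last 2 first.
  + by move=> w _; rewrite lee_fin.
  + by rewrite invr_ge0 ltW.
  apply: ge0_le_integral => //.
  + by move=> w _; rewrite lee_fin mulr_ge0// invr_ge0 ltW.
  + exact: measurable_funeM.
  move=> w _; rewrite lee_fin mulrC ler_pdivrMr// ler_wpM2l ?expR_ge0//.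
  by case: (Z t w) => x [] /=; rewrite /s ?lerDl ?lerDr ltW.
- rewrite -ge0_integralZl_EFin//; last 2 first.
  + by move=> w _; rewrite lee_fin.
  + exact: ltW.
  apply: ge0_le_integral => //.
  + exact: measurable_funeM.
  move=> w _; rewrite lee_fin mulrCA ler_peMr ?expR_ge0//.
  rewrite -ler_pdivrMr// mul1r.
  by case: (Z t w) => x [] /=; rewrite /r ?lerDl ?lerDr invr_ge0 ltW.
Qed.

End RunAndTumbleProcess.

(** * Exponential rates as limits *)

Section LogRate.
Context {R : realType}.
Implicit Types (m : R -> \bar R) (a c C : R).

(** A multiplicative constant contributes ln c / t to the rate, which vanishes as
    t grows. *)
Lemma lne_rate_ge (m : \bar R) (a c t : R) : 0 < c -> 0 < t ->
  ((c * expR (a * t))%:E <= m)%E ->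
  ((t^-1 * ln c + a)%:E <= (t^-1)%:E * lne m)%E.
Proof.
move=> c0 t0 cm; have ce0 : 0 < c * expR (a * t) by rewrite mulr_gt0 ?expR_gt0.
have -> : t^-1 * ln c + a = t^-1 * ln (c * expR (a * t)).
  by rewrite lnM ?posrE ?expR_gt0// expRK mulrDr mulrCA mulVf ?mulr1 ?gt_eqF.
rewrite EFinM; apply: lee_wpmul2l; first by rewrite lee_fin invr_ge0 ltW.
have m0 : (0 <= m)%E by apply: le_trans cm; rewrite lee_fin ltW.
by rewrite -lne_EFin// lee_lne// in_itv/= leey andbT// lee_fin ltW.
Qed.

Lemma lne_rate_le (m : \bar R) (a c t : R) : 0 < c -> 0 < t ->
  (0 <= m)%E -> (m <= (c * expR (a * t))%:E)%E ->
  ((t^-1)%:E * lne m <= (t^-1 * ln c + a)%:E)%E.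
Proof.
move=> c0 t0 m0 cm; have ce0 : 0 < c * expR (a * t) by rewrite mulr_gt0 ?expR_gt0.
have -> : t^-1 * ln c + a = t^-1 * ln (c * expR (a * t)).
  by rewrite lnM ?posrE ?expR_gt0// expRK mulrDr mulrCA mulVf ?mulr1 ?gt_eqF.
rewrite EFinM; apply: lee_wpmul2l; first by rewrite lee_fin invr_ge0 ltW.
by rewrite -lne_EFin// lee_lne// in_itv/= leey andbT// lee_fin ltW.
Qed.

Lemma cvg_inv_pinfty (k : R) : t^-1 * k @[t --> +oo] --> (0 : R).
Proof.
rewrite -[X in _ --> X](mul0r k); apply: cvgMl.
by apply/gtr0_cvgV0; [exact: nbhs_pinfty_gt|exact: cvg_id].
Qed.

Lemma cvg_lne_rate a c : (t^-1 * ln c + a)%:E @[t --> +oo] --> a%:E.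
Proof.
apply: cvg_EFin; first exact: nearW.
rewrite -[X in _ --> X]add0r; apply: cvgD; last exact: cvg_cst.
exact: cvg_inv_pinfty.
Qed.

Lemma cvg_log_rate m a c C : 0 < c -> 0 < C ->
  (\forall t \near +oo, ((c * expR (a * t))%:E <= m t <= (C * expR (a * t))%:E)%E) ->
  ((t^-1)%:E * lne (m t))%E @[t --> +oo] --> a%:E.
Proof.
move=> c0 C0 mb.
apply: (@squeeze_cvge _ _ _ _ _ _ _ _ _ (cvg_lne_rate a c) (cvg_lne_rate a C)).
near=> t.
have t0 : 0 < t by near: t; exact: nbhs_pinfty_gt.
have /andP[lo up] : ((c * expR (a * t))%:E <= m t <= (C * expR (a * t))%:E)%E.
  by near: t.
rewrite lne_rate_ge//= lne_rate_le//; apply: le_trans lo.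
by rewrite lee_fin mulr_ge0 ?expR_ge0// ltW.
Unshelve. all: by end_near. Qed.

Lemma limf_esup_log_rate_le m a C : 0 < C -> (forall t : R, (0 <= m t)%E) ->
  (\forall t \near +oo, (m t <= (C * expR (a * t))%:E)%E) ->
  (limf_esup (fun t : R => (t^-1)%:E * lne (m t)) (pinfty_nbhs R) <= a%:E)%E.
Proof.
move=> C0 m0 mb; apply/lee_addgt0Pr => e e0.
pose V := [set t : R | ((t^-1)%:E * lne (m t) <= (a + e)%:E)%E].
rewrite limf_esupE; apply: ge_ereal_inf.
exists (ereal_sup ((fun t => ((t^-1)%:E * lne (m t))%E) @` V)); last first.
  by apply: ge_ereal_sup => _ [t Vt <-]; rewrite -EFinD.
exists V => //; rewrite /V.
near=> t => /=.
have t0 : 0 < t by near: t; exact: nbhs_pinfty_gt.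
apply: le_trans (lne_rate_le _ a C t C0 t0 (m0 t) _) _; first by near: t.
rewrite lee_fin addrC lerD2l; near: t.
have := cvg_inv_pinfty (ln C); by move=> /cvgr_le; apply.
Unshelve. all: by end_near. Qed.

Lemma limf_einf_log_rate_ge m a c : 0 < c ->
  (\forall t \near +oo, ((c * expR (a * t))%:E <= m t)%E) ->
  (a%:E <= limf_einf (fun t : R => (t^-1)%:E * lne (m t)) (pinfty_nbhs R))%E.
Proof.
move=> c0 mb; apply/lee_subgt0Pr => e e0.
pose V := [set t : R | ((a - e)%:E <= (t^-1)%:E * lne (m t))%E].
rewrite limf_einfE; apply: le_ereal_sup_tmp.
exists (ereal_inf ((fun t => ((t^-1)%:E * lne (m t))%E) @` V)); last first.
  by apply: le_ereal_inf_tmp => _ [t Vt <-]; rewrite -EFinB.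
exists V => //; rewrite /V.
near=> t => /=.
have t0 : 0 < t by near: t; exact: nbhs_pinfty_gt.
apply: le_trans (lne_rate_ge _ a c t c0 t0 _); last by near: t.
rewrite lee_fin addrC lerD2r; near: t.
have := cvg_inv_pinfty (ln c); by move=> /cvgr_ge; apply; rewrite oppr_lt0.
Unshelve. all: by end_near. Qed.

End LogRate.

(** * From exponential moments to large deviations *)

(** The infimum of the norm is attained: only a bounded part of the closed set
    matters, and it is compact. *)
Lemma closed_exists_min_norm {R : realType} (B : set R) : closed B -> B !=set0 ->
  exists2 b, B b & forall x, B x -> `|b| <= `|x|.
Proof.
move=> cB [b0 Bb0]; pose A := B `&` `[- `|b0|, `|b0|].
have cA : compact A.
  apply: (subclosed_compact _ (@segment_compact _ (- `|b0|) `|b0|)).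
    by apply: closedI => //; exact: interval_closed.
  exact: subIsetr.
have A0 : A !=set0.
  by exists b0; split => //=; rewrite in_itv/= -ler_norml.
have [b] := compact_EVT_min A0 cA (continuous_subspaceT (@norm_continuous _ R^o)).
rewrite inE => -[Bb _] bmin; exists b => // x Bx.
have [xb|bx] := leP `|x| `|b0|.
  by apply: bmin; rewrite inE; split => //=; rewrite in_itv/= -ler_norml.
apply: le_trans (ltW bx); apply: bmin; rewrite inE; split => //=.
by rewrite in_itv/= -ler_norml.
Qed.

(** Strict one-sided improvements over the tangent line tilted by e; these are
    what makes both tails of the tilted law exponentially small. *)
Lemma is_derive_slope {R : realType} (f : R -> R) (a x e : R) :
  is_derive a 1 f x -> 0 < e ->
  exists2 s : R, 0 < s & f (a + s) < f a + s * (x + e) /\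
                         f (a - s) < f a - s * (x - e).
Proof.
move=> [df fx] e0.
have : h^-1 *: (f (h *: 1 + a) - f a) @[h --> 0^'] --> x.
  by rewrite -fx; exact: df.
move=> /cvgr_dist_lt/(_ e e0)[r /= r0 H].
have s0 : 0 < r / 2 by exact: divr_gt0.
have Hr (h : R) : `|h| = r / 2 -> `|x - h^-1 * (f (a + h) - f a)| < e.
  move=> hr; rewrite (addrC a); have := H h.
  rewrite /= sub0r normrN hr [h *: 1]mulr1; apply.
    by rewrite ltr_pdivrMr// ltr_pMr// ltr1n.
  by rewrite -normr_gt0 hr.
exists (r / 2) => //; set s := r / 2 in s0 Hr *; split.
- have := Hr s (gtr0_norm s0); rewrite ltr_norml => /andP[h _].
  have E : s * (s^-1 * (f (a + s) - f a)) = f (a + s) - f a by rewrite mulVKf ?gt_eqF.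
  have : s * (s^-1 * (f (a + s) - f a)) < s * (x + e) by rewrite ltr_pM2l//; lra.
  by rewrite E; lra.
- have := Hr (- s); rewrite normrN => /(_ (gtr0_norm s0)).
  rewrite ltr_norml => /andP[_ h].
  have E : s * ((- s)^-1 * (f (a - s) - f a)) = - (f (a - s) - f a).
    by rewrite invrN mulrA mulrN mulNr divff ?mul1r// gt_eqF.
  have : s * (x - e) < s * ((- s)^-1 * (f (a - s) - f a)) by rewrite ltr_pM2l//; lra.
  by rewrite E; lra.
Qed.

Section GartnerEllis.
Context {R : realType} {d : measure_display} {T : measurableType d}.
Variables (P : probability T R) (X : R -> T -> R) (F : R -> R).
Hypothesis mX : forall t, 0 <= t -> measurable_fun setT (X t).
Hypothesis mgf : forall alpha : R, exists c C : R, [/\ 0 < c, 0 < C &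
  forall t, 0 < t ->
   ((c * expR (F alpha * t))%:E <= 'E_P[fun w => expR (alpha * X t w)]
    <= (C * expR (F alpha * t))%:E)%E].

Local Notation Y := (fun t w => X t w / t).

Lemma measurable_expRZ alpha t : 0 <= t ->
  measurable_fun setT (fun w => expR (alpha * X t w)).
Proof.
move=> t0; apply: measurableT_comp => //; apply: measurable_funM => //; exact: mX.
Qed.

Lemma measurable_slope_event t (B : set R) : 0 <= t -> measurable B ->
  measurable (Y t @^-1` B).
Proof.
move=> t0 mB; rewrite -[X in measurable X]setTI.
have : measurable_fun setT (Y t) by apply: measurable_funM => //; exact: mX.
by move=> /(_ measurableT B mB).
Qed.

(** Chernoff's inequality for both tails at once, from
    expR |alpha y| <= expR (alpha y) + expR (- alpha y). *)
Lemma chernoff_abs (alpha m t : R) (B : set R) : measurable B ->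
  0 <= alpha -> 0 < t -> (forall x, B x -> m <= `|x|) ->
  (P (Y t @^-1` B) <= (expR (- (alpha * m * t)))%:E *
     ('E_P[fun w => expR (alpha * X t w)]
      + 'E_P[fun w => expR (- alpha * X t w)]))%E.
Proof.
move=> mB a0 t0 Bm; have mE := measurable_slope_event _ _ (ltW t0) mB.
have mx b : measurable_fun setT (fun w => (expR (b * X t w))%:E).
  by apply/measurable_EFinP/measurable_expRZ/ltW.
rewrite unlock -ge0_integralD//.
rewrite -ge0_integralZl_EFin ?expR_ge0//; last 2 first.
- by move=> w _; rewrite -EFinD lee_fin addr_ge0 ?expR_ge0.
- exact: emeasurable_funD.
have <- : (\int[P]_w (\1_(Y t @^-1` B) w)%:E = P (Y t @^-1` B))%E.
  by rewrite integral_indic// setIT.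
apply: ge0_le_integral => //.
- by apply/measurable_EFinP.
- by apply: measurable_funeM; exact: emeasurable_funD.
move=> w _; rewrite lee_fin indicE; case: (boolP (_ \in _)) => [|_] /=; last first.
  by rewrite mulr_ge0 ?addr_ge0 ?expR_ge0.
rewrite inE /= => /Bm mY; rewrite mulrDr -!expRD.
have : m * t <= `|X t w|.
  by rewrite -ler_pdivlMr// -[X in _ / X](gtr0_norm t0) -normf_div.
have e1 := expR_ge0 (- (alpha * m * t) + alpha * X t w).
have e2 := expR_ge0 (- (alpha * m * t) + - alpha * X t w).
have ax := fun y (h : m * t <= y) => ler_wpM2l a0 h.
case: (ger0P (X t w)) => _ /ax le.
- suff : 1 <= expR (- (alpha * m * t) + alpha * X t w) by lra.
  by rewrite -expR0 ler_expR; lra.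
- suff : 1 <= expR (- (alpha * m * t) + - alpha * X t w) by lra.
  by rewrite -expR0 ler_expR; lra.
Qed.

(** Chernoff's bound at the distance m = |b| from the origin to B.  Evenness of F
    lets every alpha be replaced by its absolute value, so optimizing over
    alpha gives the rate at b itself. *)
Lemma ldp_upper (B : set R) : (forall alpha, F (- alpha) = F alpha) -> closed B ->
  (limf_esup (fun t : R => (t^-1)%:E * lne (P (Y t @^-1` B))) (pinfty_nbhs R)
      <= - ereal_inf (legendre F @` B))%E.
Proof.
move=> Feven cB; have mB := closed_measurable cB.
have upper (a m : R) : 0 <= a -> (forall x, B x -> m <= `|x|) ->
  (limf_esup (fun t : R => (t^-1)%:E * lne (P (Y t @^-1` B))) (pinfty_nbhs R)
    <= (F a - a * m)%:E)%E.
  move=> a0 Bm.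
  have [c1 [C1 [_ C10 M1]]] := mgf a.
  have [c2 [C2 [_ C20 M2]]] := mgf (- a).
  apply: (@limf_esup_log_rate_le _ _ _ (C1 + C2)).
  - exact: addr_gt0.
  - by [].
  near=> t.
  have t0 : 0 < t by near: t; exact: nbhs_pinfty_gt.
  apply: le_trans (chernoff_abs a m t B mB a0 t0 Bm) _.
  have /andP[_ U1] := M1 t t0; have /andP[_ U2] := M2 t t0.
  apply: (@le_trans _ _ ((expR (- (a * m * t)))%:E *
    ((C1 * expR (F a * t))%:E + (C2 * expR (F (- a) * t))%:E))%E).
    by apply: lee_wpmul2l; [rewrite lee_fin expR_ge0|exact: leeD].
  rewrite -EFinD -EFinM lee_fin Feven -mulrDl mulrCA -expRD.
  by apply: ler_wpM2l; [rewrite addr_ge0// ltW|rewrite ler_expR; lra].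
have [->|/set0P B0] := eqVneq B set0.
  rewrite image_set0 ereal_inf0 /=.
  rewrite limf_esupE; apply: ge_ereal_inf; exists -oo%E => //.
  exists [set t : R | 0 < t].
    exact: nbhs_pinfty_gt.
  apply/eqP; rewrite -leeNy_eq; apply: ge_ereal_sup => _ [t /= t0 <-].
  by rewrite preimage_set0 measure0 le0_lneNy// gt0_muleNy// lte_fin invr_gt0.
have [b Bb bmin] := closed_exists_min_norm B cB B0.
apply: (@le_trans _ _ (- legendre F b)%E); last first.
  by rewrite leeN2; apply: ereal_inf_lbound; exists b.
rewrite leeNr; apply: ge_ereal_sup => _ [a _ <-].
rewrite leeNr -EFinN; apply: le_trans (upper `|a| `|b| (normr_ge0 _) bmin) _.
have -> : F `|a| = F a by case: (ger0P a).
by rewrite lee_fin opprB lerD2l lerN2 -normrM ler_norm.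
Unshelve. all: by end_near. Qed.

(** Splitting the mean of expR (a X_t) over |X_t / t - x| < e and the two tails.
    On the ball the integrand is almost constant; on the upper tail it is at
    most expR ((a + s) X_t) expR (- s (x + e) t), and symmetrically on the lower
    one. *)
Lemma mgf_split (a x e s t : R) : 0 < t -> 0 < s -> 0 < e ->
  ('E_P[fun w => expR (a * X t w)] <=
   (expR ((a * x + `|a| * e) * t))%:E * P (Y t @^-1` ball x e)
   + ((expR (- (s * (x + e) * t)))%:E * 'E_P[fun w => expR ((a + s) * X t w)]
   + (expR (s * (x - e) * t))%:E * 'E_P[fun w => expR ((a - s) * X t w)]))%E.
Proof.
move=> t0 s0 e0; have t0' := ltW t0.
have mE : measurable (Y t @^-1` ball x e).
  by apply: measurable_slope_event => //; exact: measurable_ball.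
have mx b : measurable_fun setT (fun w => (expR (b * X t w))%:E).
  by apply/measurable_EFinP; exact: measurable_expRZ.
have mi : measurable_fun setT (fun w => (\1_(Y t @^-1` ball x e) w)%:E : \bar R).
  by apply/measurable_EFinP.
have <- : (\int[P]_w (\1_(Y t @^-1` ball x e) w)%:E = P (Y t @^-1` ball x e))%E.
  by rewrite integral_indic// setIT.
rewrite unlock -!ge0_integralZl_EFin ?expR_ge0//.
have mz b c : measurable_fun setT (fun w => (b%:E * (expR (c * X t w))%:E)%E).
  exact: measurable_funeM.
have mzi b : measurable_fun setT
    (fun w => (b%:E * (\1_(Y t @^-1` ball x e) w)%:E)%E : \bar R).
  exact: measurable_funeM.
have z0 b c w : (0 <= (expR b)%:E * (expR (c * X t w))%:E)%E.
  by rewrite lee_fin mulr_ge0 ?expR_ge0.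
have zi0 b w : (0 <= (expR b)%:E * (\1_(Y t @^-1` ball x e) w)%:E)%E.
  by rewrite lee_fin mulr_ge0 ?expR_ge0.
rewrite -ge0_integralD// -ge0_integralD//; last 2 first.
- by move=> w _; exact: adde_ge0.
- exact: emeasurable_funD.
apply: ge0_le_integral => //.
- by apply: emeasurable_funD => //; exact: emeasurable_funD.
move=> w _; rewrite -!EFinM -!EFinD lee_fin -!expRD.
set y := X t w.
have E1 := expR_ge0 (- (s * (x + e) * t) + (a + s) * y).
have E2 := expR_ge0 (s * (x - e) * t + (a - s) * y).
have E3 := expR_gt0 ((a * x + `|a| * e) * t).
rewrite indicE; case: (boolP (_ \in _)) => /=.
- rewrite mulr1 inE /= -ball_normE /= -/y => yx.
  apply: (@le_trans _ _ (expR ((a * x + `|a| * e) * t))); last by lra.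
  rewrite ler_expR -ler_pdivrMr// -mulrA -lerBlDl -mulrBr.
  apply: le_trans (ler_norm _) _; rewrite normrM ler_wpM2l//.
  by rewrite distrC ltW.
- rewrite mulr0 add0r notin_setE /= -ball_normE /= -/y => /negP.
  rewrite -leNgt distrC => xy.
  have : (x + e) * t <= y \/ y <= (x - e) * t.
    case: (ger0P (y / t - x)) xy => h xy.
    + by left; rewrite -ler_pdivlMr//; lra.
    + by right; rewrite -ler_pdivrMr//; lra.
  case=> h.
  + suff : expR (a * y) <= expR (- (s * (x + e) * t) + (a + s) * y) by lra.
    by rewrite ler_expR; have := ler_wpM2l (ltW s0) h; lra.
  + suff : expR (a * y) <= expR (s * (x - e) * t + (a - s) * y) by lra.
    by rewrite ler_expR; have := ler_wpM2l (ltW s0) h; lra.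
Qed.

(** With x a slope of F at a, the tail terms of [mgf_split] are at most of order
    expR ((F a - eta) t) with eta > 0, while the whole mean is of order
    expR (F a t).  So the ball term carries at least half of the lower bound. *)
Lemma slope_ball_lower (a x e : R) : is_derive a 1 F x -> 0 < e ->
  exists2 c : R, 0 < c & \forall t \near +oo,
    ((c * expR ((F a - a * x - `|a| * e) * t))%:E <= P (Y t @^-1` ball x e))%E.
Proof.
move=> dF e0.
have [s s0 [Fs1 Fs2]] := is_derive_slope F a x e dF e0.
have [c [C [c0 C0 M]]] := mgf a.
have [c1 [C1 [c10 C10 M1]]] := mgf (a + s).
have [c2 [C2 [c20 C20 M2]]] := mgf (a - s).
exists (c / 2); first exact: divr_gt0.
pose eta := Num.min (F a + s * (x + e) - F (a + s)) (F a - s * (x - e) - F (a - s)).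
have eta0 : 0 < eta by rewrite lt_min !subr_gt0 Fs1 Fs2.
near=> t.
have t0 : 0 < t by near: t; exact: nbhs_pinfty_gt.
have small : (C1 + C2) * expR (- (eta * t)) <= c / 2.
  rewrite mulrC -ler_pdivlMr ?addr_gt0// expRN -[leRHS]invrK.
  have q0 : 0 < (c / 2 / (C1 + C2))^-1.
    by rewrite invr_gt0; apply: divr_gt0; [exact: divr_gt0|exact: addr_gt0].
  rewrite lef_pV2 ?posrE ?expR_gt0//.
  apply: (@le_trans _ _ (1 + eta * t)); last exact: expR_ge1Dx.
  have : (c / 2 / (C1 + C2))^-1 / eta <= t.
    by near: t; apply: nbhs_pinfty_ge; exact: num_real.
  rewrite ler_pdivrMr// mulrC => h; lra.
have /andP[L _] := M t t0; have /andP[_ U1] := M1 t t0; have /andP[_ U2] := M2 t t0.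
have := le_trans L (mgf_split a x e s t t0 s0 e0).
have mB : measurable (Y t @^-1` ball x e).
  by apply: measurable_slope_event; [exact: ltW|exact: measurable_ball].
rewrite -[P _]fineK ?fin_num_measure//.
set p := fine _.
have V1 : ((expR (- (s * (x + e) * t)))%:E * 'E_P[fun w => expR ((a + s) * X t w)]
   <= (C1 * expR ((F a - eta) * t))%:E)%E.
  apply: le_trans (lee_wpmul2l _ U1) _; first by rewrite lee_fin expR_ge0.
  rewrite -EFinM lee_fin mulrCA -expRD.
  apply: ler_wpM2l; first exact: ltW.
  rewrite ler_expR.
  have : eta <= F a + s * (x + e) - F (a + s) by rewrite /eta ge_min lexx.
  by move=> /(ler_wpM2r (ltW t0)); lra.
have V2 : ((expR (s * (x - e) * t))%:E * 'E_P[fun w => expR ((a - s) * X t w)]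
   <= (C2 * expR ((F a - eta) * t))%:E)%E.
  apply: le_trans (lee_wpmul2l _ U2) _; first by rewrite lee_fin expR_ge0.
  rewrite -EFinM lee_fin mulrCA -expRD.
  apply: ler_wpM2l; first exact: ltW.
  rewrite ler_expR.
  have : eta <= F a - s * (x - e) - F (a - s) by rewrite /eta ge_min lexx orbT.
  by move=> /(ler_wpM2r (ltW t0)); lra.
move=> /le_trans/(_ (leeD2l _ (leeD V1 V2))).
rewrite -EFinM -!EFinD !lee_fin => main.
have Fa0 := expR_gt0 (F a * t).
have small' : C1 * expR ((F a - eta) * t) + C2 * expR ((F a - eta) * t)
    <= c / 2 * expR (F a * t).
  have -> : (F a - eta) * t = - (eta * t) + F a * t by ring.
  rewrite -mulrDl expRD mulrA.
  by apply: ler_wpM2r => //; exact: ltW.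
have Ea0 := expR_gt0 ((a * x + `|a| * e) * t).
rewrite -(ler_pM2l Ea0) mulrCA -expRD.
have -> : (a * x + `|a| * e) * t + (F a - a * x - `|a| * e) * t = F a * t by ring.
lra.
Unshelve. all: by end_near. Qed.

(** At a slope x of F at a the local rate F a - a x is at least minus the rate
    function; letting the radius of the ball shrink removes the error |a| e. *)
Lemma ldp_lower (G : set R) :
  (forall x, (exists a : R, is_derive a 1 F x) \/ legendre F x = +oo%E) ->
  open G ->
  (- ereal_inf (legendre F @` G) <=
    limf_einf (fun t : R => (t^-1)%:E * lne (P (Y t @^-1` G))) (pinfty_nbhs R))%E.
Proof.
move=> slopes oG; rewrite leeNl; apply: le_ereal_inf_tmp => _ [x Gx <-].
rewrite leeNl; have [[a dF]|->] := slopes x; last by rewrite leNye.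
apply: (@le_trans _ _ (F a - a * x)%:E).
  rewrite leeNl -EFinN opprB; apply: ereal_sup_ubound; by exists a.
have mG := open_measurable oG.
have [r /= r0 rG] : nbhs x G by exact: open_nbhs_nbhs.
apply/lee_subgt0Pr => e e0.
(* the added 1 covers a = 0 *)
pose e' := Num.min r (e / (`|a| + 1)).
have a1 : 0 < `|a| + 1 by rewrite ltr_wpDl.
have e'0 : 0 < e' by rewrite lt_min r0 divr_gt0.
have [c c0 H] := slope_ball_lower a x e' dF e'0.
apply: (@le_trans _ _ (F a - a * x - `|a| * e')%:E).
  rewrite -EFinB lee_fin lerD2l lerN2.
  apply: (@le_trans _ _ ((`|a| + 1) * e')).
    by rewrite ler_wpM2r ?lerDl// ltW.
  by rewrite mulrC -ler_pdivlMr// /e' ge_min lexx orbT.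
apply: (limf_einf_log_rate_ge _ _ c c0).
near=> t.
have t0 : 0 < t by near: t; exact: nbhs_pinfty_gt.
apply: (@le_trans _ _ (P (Y t @^-1` ball x e'))); first by near: t; exact: H.
apply: le_measure; rewrite ?inE.
- by apply: measurable_slope_event; [exact: ltW|exact: measurable_ball].
- by apply: measurable_slope_event => //; exact: ltW.
- move=> w; rewrite /= -ball_normE /= => h; apply: rG => /=.
  by apply: lt_le_trans h _; rewrite /e' ge_min lexx.
Unshelve. all: by end_near. Qed.

End GartnerEllis.

(** * Slopes of the free energy *)

Section FreeEnergy.
Context {R : realType}.

Variables lambda kappa gamma : R.
Hypotheses (lambda_ge0 : 0 <= lambda) (kappa_ge0 : 0 <= kappa)
  (gamma_gt0 : 0 < gamma).

Local Notation F := (rt_free_energy lambda kappa gamma).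
Local Notation root a :=
  (Num.sqrt (gamma ^+ 2 + lambda ^+ 2 * sinh a ^+ 2)).

Lemma rt_free_energyN (a : R) : F (- a) = F a.
Proof. by rewrite /rt_free_energy coshN sinhN sqrrN. Qed.

(** The derivative of F: the asymptotic velocity of the process tilted by a. *)
Definition rt_speed (a : R) : R :=
  (2 * kappa + lambda) * sinh a + lambda ^+ 2 * sinh a * cosh a / root a.

Lemma is_derive_rt_free_energy (a : R) : is_derive a 1 F (rt_speed a).
Proof.
have dc := is_derive_cosh a; have ds := is_derive_sinh a.
have r0 := rt_discriminant_gt0 lambda gamma gamma_gt0 a.
have dr := is_derive1_sqrt r0.
have dd : is_derive a 1 (fun b => gamma ^+ 2 + lambda ^+ 2 * sinh b ^+ 2)
    (lambda ^+ 2 * (2 * sinh a * cosh a)).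
  apply: is_derive_eq; rewrite /GRing.scale /=; ring.
have dq : is_derive a 1 (fun b => root b)
    ((2 * root a)^-1 * (lambda ^+ 2 * (2 * sinh a * cosh a))).
  exact: (@is_derive1_comp R Num.sqrt
    (fun b => gamma ^+ 2 + lambda ^+ 2 * sinh b ^+ 2)).
rewrite /rt_free_energy; apply: is_derive_eq.
rewrite /rt_speed /GRing.scale /=; field.
by rewrite gt_eqF// sqrtr_gt0.
Qed.

Lemma continuous_rt_speed : continuous rt_speed.
Proof.
have cs : continuous (@sinh R).
  by move=> a; apply/differentiable_continuous/derivable1_diffP; apply: ex_derive;
    exact: is_derive_sinh.
have cc : continuous (@cosh R).
  by move=> a; apply/differentiable_continuous/derivable1_diffP; apply: ex_derive;
    exact: is_derive_cosh.
move=> a; apply: cvgD; first by apply: cvgMr; exact: cs.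
apply: cvgM; first by apply: cvgM; [apply: cvgMr; exact: cs|exact: cc].
apply: cvgV.
  by rewrite gt_eqF// sqrtr_gt0 rt_discriminant_gt0.
apply: (@continuous_comp _ _ _
  (fun b => gamma ^+ 2 + lambda ^+ 2 * sinh b ^+ 2) Num.sqrt).
  apply: cvgD; first exact: cvg_cst.
  apply: cvgMr; apply: (@continuous_comp _ _ _ (@sinh R) (fun x => x ^+ 2)).
    exact: cs.
  exact: exprn_continuous.
exact: sqrt_continuous.
Qed.

(** Both terms of the derivative are nonnegative for a >= 0, and the first one is
    unbounded as soon as its coefficient is positive. *)
Lemma rt_speed_ge (a : R) : 0 <= a -> (2 * kappa + lambda) * (a / 2) <= rt_speed a.
Proof.
move=> a0; have s0 : 0 <= sinh a by apply: le_trans (sinh_ge a a0); exact: divr_ge0.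
have c0 : 0 <= 2 * kappa + lambda by rewrite addr_ge0// mulr_ge0.
apply: (@le_trans _ _ ((2 * kappa + lambda) * sinh a)).
  by rewrite ler_wpM2l// sinh_ge.
rewrite /rt_speed lerDl divr_ge0 ?sqrtr_ge0// mulr_ge0//; last first.
  exact: le_trans (cosh_ge1 a).
by rewrite mulr_ge0// sqr_ge0.
Qed.

Lemma rt_speedN (a : R) : rt_speed (- a) = - rt_speed a.
Proof. by rewrite /rt_speed coshN sinhN sqrrN; ring. Qed.

Lemma rt_speed_surjective (x : R) : 0 < 2 * kappa + lambda ->
  exists a, rt_speed a = x.
Proof.
(* A is the point where the linear lower bound of [rt_speed_ge] reaches |x| *)
move=> c0; pose A := 2 * `|x| / (2 * kappa + lambda).
have A0 : 0 <= A by rewrite divr_ge0 ?mulr_ge0// ltW.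
have xA : `|x| <= rt_speed A.
  have <- : (2 * kappa + lambda) * (A / 2) = `|x|.
    by rewrite /A; field; rewrite gt_eqF.
  exact: rt_speed_ge.
have [|||a _ <-] := @IVT _ rt_speed (- A) A x; last by exists a.
- by rewrite (le_trans _ A0)// oppr_le0.
- exact/continuous_subspaceT/continuous_rt_speed.
- move: xA; rewrite rt_speedN ler_norml => /andP[h1 h2].
  by rewrite ge_min le_max h1 h2 orbT.
Qed.

(** The particle does not move, F vanishes, and a x is unbounded in a. *)
Lemma legendre_eq_pinfty (x : R) : 2 * kappa + lambda = 0 -> x != 0 ->
  legendre F x = +oo%E.
Proof.
move=> c0 x0.
have F0 a : F a = 0.
  have l0 : lambda = 0.
    apply/eqP; rewrite eq_le lambda_ge0 andbT -c0 lerDr.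
    exact: mulr_ge0.
  rewrite /rt_free_energy c0 l0 expr0n/= !mul0r addr0 add0r sqrtr_sqr.
  by rewrite gtr0_norm// subrr.
apply/eqyP => r r0; apply: ereal_sup_ubound; exists (r / x) => //.
by rewrite F0 subr0 divfK.
Qed.

Lemma rt_free_energy_slopes (x : R) :
  (exists a : R, is_derive a 1 F x) \/ legendre F x = +oo%E.
Proof.
have [c0|c0] := eqVneq (2 * kappa + lambda) 0; last first.
  have cp : 0 < 2 * kappa + lambda by rewrite lt_def c0 addr_ge0// mulr_ge0.
  left; have [a <-] := rt_speed_surjective x cp; exists a.
  exact: is_derive_rt_free_energy.
have [->|x0] := eqVneq x 0; last by right; exact: legendre_eq_pinfty.
left; exists 0; have := is_derive_rt_free_energy 0.
suff -> : rt_speed 0 = 0 by [].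
by rewrite /rt_speed /sinh oppr0 subrr !(mul0r, mulr0) addr0.
Qed.
End FreeEnergy.

Theorem theorem3p1 (R : realType) (lambda kappa gamma : R)
  (lambda_ge0 : 0 <= lambda) (kappa_ge0 : 0 <= kappa) (gamma_gt0 : 0 < gamma)
  (d : measure_display) (T : measurableType d) (P : probability T R)
  (Z : R -> T -> rt_state)
  (Z_rt : run_and_tumble lambda kappa gamma P Z)
  (Z_init : forall b : bool, P [set w | Z 0 w = (0, b)] = (2^-1)%:E) :
  exists F : R -> R,
    [/\ forall alpha : R,
          log_mgf_rate P (position Z) alpha t @[t --> +oo] --> (F alpha)%:E,
        forall alpha : R,
          F alpha = (2 * kappa + lambda) * (cosh alpha - 1)
            + Num.sqrt (gamma ^+ 2 + lambda ^+ 2 * sinh alpha ^+ 2) - gamma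
      & large_deviation_principle P (fun t w => position Z t w / t)
          (legendre F)].
Proof.
have bounds := rt_moment_bounds _ _ _ lambda_ge0 kappa_ge0 gamma_gt0 P Z Z_rt Z_init.
have mX t : 0 <= t -> measurable_fun setT (position Z t).
  move=> t0; apply: (measurable_rt_process_comp _ _ _ P Z Z_rt t
    (fun z => z.1%:~R : R)) => //.
exists (rt_free_energy lambda kappa gamma); split => //.
- move=> alpha; have [c [C [c0 C0 M]]] := bounds alpha.
  apply: (cvg_log_rate _ _ c C c0 C0); near=> t; apply: M.
  by near: t; exact: nbhs_pinfty_gt.
- split=> [B|G].
  + by apply: (ldp_upper P _ _ mX bounds); exact: rt_free_energyN.
  + apply: (ldp_lower P _ _ mX bounds).
    exact: rt_free_energy_slopes.
Unshelve. all: by end_near. Qed.
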